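(* Let $\langle \pi, \equiv_\pi \rangle$ be an abstract semantics that is branching, discharging and strong smn, and let $n\geq 1$. If $A\subseteq\mathbb{N}$ is partially $\sim_\pi^n$-extensional and not universally $\sim_\pi^n$-extensional, then $A$ is not recursive.
   Context: Fix a Turing-complete programming model with a Gödel numbering of its programs; $\phi_a^{(n)}:\mathbb{N}^n\rightharpoonup\mathbb{N}$ denotes the $n$-ary partial function computed by the $a$-th program ($\phi_a=\phi_a^{(1)}$), and every partial recursive function equals some $\phi_a^{(n)}$. Let $\mathcal{F}$ denote the class of all partial functions $\mathbb{N}^n\rightharpoonup\mathbb{N}$, $n\in\mathbb{N}$. An abstract semantics is a pair $\langle\pi,\equiv_\pi\rangle$ where $\pi$ assigns to each index $a$ and arity $n$ a partial function $\pi_a^{(n)}:\mathbb{N}^n\rightharpoonup\mathbb{N}$ and $\equiv_\pi$ is an equivalence relation on $\mathcal{F}$; $a\sim_\pi^n b$ iff $\pi_a^{(n)}\equiv_\pi\pi_b^{(n)}$. Strong smn: for all $m,n\ge1$ there is a total computable $s:\mathbb{N}^{m+2}\to\mathbb{N}$ with $\lambda\vec y.\,\pi_a^{(n+1)}(\phi_b^{(m)}(\vec x),\vec y)\equiv_\pi\pi_{s(a,b,\vec x)}^{(n)}$ for all $a,b,\vec x$. Branching: for every $n\ge1$ there is a total computable $r:\mathbb{N}^4\to\mathbb{N}$ such that for all $a,b,c_1,c_2,x\in\mathbb{N}$ with $c_1\neq c_2$: $\lambda\vec y.\,\pi^{(n)}_{r(a,b,c_1,c_2)}(x,\vec y)\equiv_\pi\lambda\vec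 y.\,\pi_a^{(n)}(x,\vec y)$ if $x=c_1$, $\equiv_\pi\lambda\vec y.\,\pi_b^{(n)}(x,\vec y)$ if $x=c_2$, and $\equiv_\pi$ the everywhere undefined function otherwise. Discharging: for every $n\ge1$ there is a total computable $t:\mathbb{N}\to\mathbb{N}$ such that for all $a,x\in\mathbb{N}$: $\pi_a^{(n)}\equiv_\pi\lambda\vec y.\,\pi_{t(a)}^{(n+1)}(x,\vec y)$. For an equivalence $\sim$ on $\mathbb{N}$, $A\subseteq\mathbb{N}$ is partially $\sim$-extensional if $[a]_\sim\subseteq A$ for some $a$, and universally $\sim$-extensional if $[a]_\sim\cap A\ne\varnothing$ for all $a$. *)

(* Defs.v *)
From mathcomp Require Import all_boot.
From mathcomp Require Import boolp classical_sets.
From Stdlib Require Import Relations RelationClasses.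

Set Implicit Arguments.
Unset Strict Implicit.
Unset Printing Implicit Defensive.

Local Open Scope classical_set_scope.

(* Partial functions N^n -> N; [None] is "undefined". *)
Definition pfun (n : nat) : Type := n.-tuple nat -> option nat.

Definition undef (n : nat) : pfun n := fun=> None.

Definition anyPfun : Type := {n : nat & pfun n}.

Definition any_pfun (n : nat) (f : pfun n) : anyPfun := existT pfun n f.

(* [section f x] is \lambda y. f (x, y). *)
Definition section (n : nat) (f : pfun n.+1) (x : nat) : pfun n :=
  fun y => f [tuple of x :: y].

(* Strict composition: defined at x only if every [g i] is defined at x. *)
Definition comp_pfun (k n : nat) (f : pfun k) (g : 'I_k -> pfun n) : pfun n :=
  fun x => if [forall i, isSome (g i x)] then f [tuple odflt 0 (g i x) | i < k]
           else None.

(* h (0, y) = f y and h (i + 1, y) = g (i, h (i, y), y). *)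
Definition primrec (n : nat) (f : pfun n) (g : pfun n.+2) : pfun n.+1 :=
  fun v => let y : n.-tuple nat := [tuple of behead v] in
    iteri (thead v) (fun i r => obind (fun z => g [tuple of i :: z :: y]) r)
          (f y).

(* g x is the least y with f (y, x) = 0, all earlier values of f being defined. *)
Definition is_mu (n : nat) (f : pfun n.+1) (g : pfun n) : Prop :=
  forall x y, g x = Some y <->
    f [tuple of y :: x] = Some 0 /\
    forall z, z < y -> exists k, f [tuple of z :: x] = Some k.+1.

Inductive partial_recursive : forall n : nat, pfun n -> Prop :=
| PR_zero n : partial_recursive (fun _ : n.-tuple nat => Some 0)
| PR_succ : partial_recursive (fun x : 1.-tuple nat => Some (thead x).+1)
| PR_proj n (i : 'I_n) :
    partial_recursive (fun x : n.-tuple nat => Some (tnth x i))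
| PR_comp k n (f : pfun k) (g : 'I_k -> pfun n) :
    partial_recursive f -> (forall i, partial_recursive (g i)) ->
    partial_recursive (comp_pfun f g)
| PR_rec n (f : pfun n) (g : pfun n.+2) :
    partial_recursive f -> partial_recursive g ->
    partial_recursive (primrec f g)
| PR_mu n (f : pfun n.+1) (g : pfun n) :
    partial_recursive f -> is_mu f g -> partial_recursive g.

Definition total_recursive (n : nat) (f : n.-tuple nat -> nat) : Prop :=
  partial_recursive (fun x => Some (f x)).

Definition recursive_set (A : set nat) : Prop :=
  exists2 chi : 1.-tuple nat -> nat, total_recursive chi &
    forall a, (A a -> chi [tuple a] = 1) /\ (~ A a -> chi [tuple a] = 0).

(* [phi a n] is the n-ary partial function computed by the a-th program. *)
Definition indexing : Type := nat -> forall n : nat, pfun n.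

(* The indexing given by a Goedel numbering of the programs of a Turing-complete
   model: programs can be interpreted effectively from their number (so each
   [phi a n] is partial recursive), and compute all partial recursive functions. *)
Record goedel_numbering (phi : indexing) : Prop := GoedelNumbering {
  goedel_universal : forall n,
    partial_recursive (fun v : n.+1.-tuple nat =>
      phi (thead v) n [tuple of behead v]);
  goedel_complete : forall n (f : pfun n), partial_recursive f ->
    exists a, phi a n = f
}.

Record abstract_semantics : Type := AbstractSemantics {
  sem :> nat -> forall n : nat, pfun n;
  sem_eq : relation anyPfun;
  sem_equivalence : Equivalence sem_eq
}.

Definition sem_equiv (pi : abstract_semantics) (m n : nat)
    (f : pfun m) (g : pfun n) : Prop :=
  sem_eq pi (any_pfun f) (any_pfun g).

Definition sem_sim (pi : abstract_semantics) (n : nat) : relation nat :=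
  fun a b => sem_equiv pi (pi a n) (pi b n).

Definition strong_smn (phi : indexing) (pi : abstract_semantics) : Prop :=
  forall m n : nat, 1 <= m -> 1 <= n ->
  exists2 s : m.+2.-tuple nat -> nat, total_recursive s &
    forall (a b : nat) (x : m.-tuple nat),
      sem_equiv pi
        (fun y : n.-tuple nat =>
           obind (fun z => pi a n.+1 [tuple of z :: y]) (phi b m x))
        (pi (s [tuple of a :: b :: x]) n).

(* Arities n >= 1 are written [n.+1]. *)
Definition branching (pi : abstract_semantics) : Prop :=
  forall n : nat,
  exists2 r : 4.-tuple nat -> nat, total_recursive r &
    forall a b c1 c2 x : nat, c1 <> c2 ->
      let f := section (pi (r [tuple a; b; c1; c2]) n.+1) x in
      [/\ x = c1 -> sem_equiv pi f (section (pi a n.+1) x),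
          x = c2 -> sem_equiv pi f (section (pi b n.+1) x) &
          x <> c1 -> x <> c2 -> sem_equiv pi f (@undef n)].

Definition discharging (pi : abstract_semantics) : Prop :=
  forall n : nat, 1 <= n ->
  exists2 t : 1.-tuple nat -> nat, total_recursive t &
    forall a x : nat,
      sem_equiv pi (pi a n) (section (pi (t [tuple a]) n.+1) x).

Definition eqclass (R : relation nat) (a : nat) : set nat := [set b | R a b].

Definition partially_extensional (R : relation nat) (A : set nat) : Prop :=
  exists a, eqclass R a `<=` A.

Definition universally_extensional (R : relation nat) (A : set nat) : Prop :=
  forall a, eqclass R a `&` A !=set0.

(* Main.v *)
(* A diagonal argument. Take [a0] with class inside A and [a1] with class
   disjoint from A. Discharging and branching give a program [q] whose section
   at 1 is equivalent to [a1] and whose section at 0 is equivalent to [a0]. If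
   [chi] decides A, let [b] be a program for [x |-> chi (s (q, x, x))] with [s]
   from strong smn; then [e := s (q, b, b)] satisfies [pi_e = pi_q (chi e, -)] up
   to equivalence, so [e] is similar to [a1] if it lies in A and to [a0] if it
   does not, a contradiction either way. *)

Require Import Defs.
From mathcomp Require Import all_boot.
From mathcomp Require Import boolp classical_sets.

Lemma total_recursive_comp {k n : nat} {f : k.-tuple nat -> nat}
    {g : 'I_k -> n.-tuple nat -> nat} :
  total_recursive f -> (forall i, total_recursive (g i)) ->
  total_recursive (fun x => f [tuple g i x | i < k]).
Proof.
move=> Hf Hg; have := PR_comp Hf Hg; rewrite /total_recursive.
congr partial_recursive; apply: funext => x.
(* All components are defined, so the definedness test of [comp_pfun] always succeeds. *)
by rewrite /comp_pfun; case: forallP => // -[].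
Qed.

Lemma total_recursive_const (n c : nat) :
  total_recursive (fun _ : n.-tuple nat => c).
Proof.
elim: c => [|c IH]; first exact: PR_zero.
by have := total_recursive_comp PR_succ (fun _ : 'I_1 => IH);
  rewrite /thead; under eq_fun do rewrite tnth_mktuple.
Qed.

Lemma sem_equiv_sym { pi : abstract_semantics } {m n : nat} {f : pfun m}
    {g : pfun n} : sem_equiv pi f g -> sem_equiv pi g f.
Proof. exact: (sem_equivalence pi).(RelationClasses.Equivalence_Symmetric). Qed.

Lemma sem_equiv_trans { pi : abstract_semantics } {m n p : nat} {f : pfun m}
    {g : pfun n} {h : pfun p} :
  sem_equiv pi f g -> sem_equiv pi g h -> sem_equiv pi f h.
Proof. exact: (sem_equivalence pi).(RelationClasses.Equivalence_Transitive). Qed.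

(** Discharging gives each program a dummy first argument; branching then glues the two by cases on
    that argument. *)
Lemma exists_section_pair { pi : abstract_semantics } {n : nat} (a b c d : nat) :
  branching pi -> discharging pi -> 1 <= n -> c <> d ->
  exists q, sem_equiv pi (pi a n) (section (pi q n.+1) c) /\
            sem_equiv pi (pi b n) (section (pi q n.+1) d).
Proof.
move=> hbranch hdis hn cd.
have [t _ Ht] := hdis n hn; have [r _ Hr] := hbranch n.
exists (r [tuple t [tuple a]; t [tuple b]; c; d]); split.
- apply: sem_equiv_trans (Ht a c) (sem_equiv_sym _).
  by have [/(_ erefl)] := Hr (t [tuple a]) (t [tuple b]) c d c cd.
- apply: sem_equiv_trans (Ht b d) (sem_equiv_sym _).
  by have [_ /(_ erefl)] := Hr (t [tuple a]) (t [tuple b]) c d d cd.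
Qed.

(** A Kleene-style fixed point: strong smn substitutes a computed value into [pi q], so the
    self-reference is arranged inside [phi], with no interpreter for [pi]. *)
Lemma exists_self_section {phi : indexing} { pi : abstract_semantics }
    {n : nat} (q : nat) {chi : 1.-tuple nat -> nat} :
  goedel_numbering phi -> strong_smn phi pi -> 1 <= n -> total_recursive chi ->
  exists e, sem_equiv pi (section (pi q n.+1) (chi [tuple e])) (pi e n).
Proof.
move=> hphi hsmn hn Hchi; have [s Hs Hse] := hsmn 1 n isT hn.
pose d (x : 1.-tuple nat) := chi [tuple s [tuple q; thead x; thead x]].
have Hd : total_recursive d.
  (* [g] lists the coordinates of (q, x, x), which exhibits [d] as a composition. *)
  pose g (i : 'I_3) (x : 1.-tuple nat) := if val i == 0 then q else thead x.
  have Hg i : total_recursive (g i).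
    rewrite /g; case: (val i == 0); first exact: total_recursive_const.
    exact: PR_proj.
  have -> : d = fun x => chi [tuple s [tuple g i x | i < 3] | i < 1].
    apply: funext => x; congr chi; apply: eq_from_tnth => i.
    rewrite tnth_mktuple ord1; congr s; apply: eq_from_tnth => j.
    by rewrite tnth_mktuple /g; case: j => [[|[|[]]]].
  by apply: total_recursive_comp => // _; apply: total_recursive_comp.
have [b Hb] := goedel_complete hphi Hd.
(* As [d] is total, [phi b] is defined at [b] itself, with value [chi] of s (q, b, b), and the
   [obind] collapses to a section of [pi q]. *)
have := Hse q b [tuple b]; rewrite Hb /=.
have -> : [tuple of q :: b :: [tuple b]] = [tuple q; b; b] by apply: val_inj.
by exists (s [tuple q; b; b]).
Qed.

Theorem mainTheorem3 (phi : indexing) (hphi : goedel_numbering phi)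
    (pi : abstract_semantics)
    (hbranch : branching pi) (hdis : discharging pi) (hsmn : strong_smn phi pi)
    (n : nat) (hn : 1 <= n) (A : set nat)
    (hpart : partially_extensional (sem_sim pi n) A)
    (huniv : ~ universally_extensional (sem_sim pi n) A) :
  ~ recursive_set A.
Proof.
case=> chi Hchi HA; have [a0 Ha0] := hpart.
apply: huniv => a1; apply: contrapT => Ha1.
have [q [Hq1 Hq0]] :=
  exists_section_pair a1 a0 1 0 hbranch hdis hn (not_eq_sym (O_S 0)).
have [e He] := exists_self_section q hphi hsmn hn Hchi.
have [eA | neA] := pselect (A e).
(* [e] itself is a common point of [A] and the class of [a1]. *)
- apply: Ha1; exists e; split=> //.
  by move: He; rewrite (HA e).1 //; apply: sem_equiv_trans.
- apply: (neA); apply: Ha0.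
  by move: He; rewrite (HA e).2 //; apply: sem_equiv_trans.
Qed.
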